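(* Let $\mathbf{A}\in\mathbb{R}^{m\times d}$ have full row rank, let $\mathbf{b}\in\mathbb{R}^m$, $\mathbf{c}\in\mathbb{R}^d$, and let $\varepsilon>0$. Assume that there exists $x_0\in\mathbb{R}^d$ with $\mathbf{A}x_0=\mathbf{b}$ and $x_0>0$ (componentwise). Let $$G_\varepsilon(\lambda):=\mathbf{b}^T\lambda-\frac{\varepsilon}{e}\sum_{i=1}^d\exp\big((\mathbf{A}^T\lambda-\mathbf{c})_i/\varepsilon\big),\qquad\lambda\in\mathbb{R}^m.$$ Then $-G_\varepsilon$ is coercive, that is, $G_\varepsilon(\lambda)\to-\infty$ as $\Vert\lambda\Vert\to+\infty$.
   Context: $\Vert\cdot\Vert$ denotes the Euclidean norm on $\mathbb{R}^m$, and $e=\exp(1)$. *)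

(* Defs.v *)
From HB Require Import structures.
From mathcomp Require Import all_boot all_order all_algebra.
From mathcomp Require Import all_classical all_reals all_analysis.

Set Implicit Arguments.
Unset Strict Implicit.
Unset Printing Implicit Defensive.

Import Order.TTheory GRing.Theory Num.Theory.
Import numFieldNormedType.Exports.

Local Open Scope classical_set_scope.
Local Open Scope ring_scope.

(* The library's norm [`|v|] on matrices is the max norm, hence this one. *)
Definition enorm (R : realType) (m : nat) (v : 'cV[R]_m) : R :=
  Num.sqrt (\sum_(i < m) v i 0 ^+ 2).

(* The filter of [enorm v --> +oo]; it is improper when [m = 0]. *)
Definition enorm_infty (R : realType) (m : nat) : set_system 'cV[R]_m :=
  filter_from [set: R] (fun r => [set v | r < enorm v]).

Arguments enorm_infty : clear implicits.

Definition coercive (R : realType) (m : nat) (f : 'cV[R]_m -> R) : Prop :=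
  f v @[v --> enorm_infty R m] --> +oo.

Definition Geps (R : realType) (m d : nat) (A : 'M[R]_(m, d))
    (b : 'cV[R]_m) (c : 'cV[R]_d) (eps : R) (l : 'cV[R]_m) : R :=
  (b^T *m l) 0 0
  - eps / expR 1 * \sum_(i < d) expR ((A^T *m l - c) i 0 / eps).

(* Main.v *)
Require Import Defs.
From HB Require Import structures.
From mathcomp Require Import all_boot all_order all_algebra.
From mathcomp Require Import all_classical all_reals all_analysis.
From mathcomp Require Import ring lra.
Import Order.TTheory GRing.Theory Num.Theory.
Import numFieldNormedType.Exports.
Local Open Scope classical_set_scope.
Local Open Scope ring_scope.

(** Put [y = A^T l].  Since [b = A x0], one has [b^T l = x0^T y], so [- G] is a
    sum of functions [k exp ((y_i - c_i) / eps) - x0_i y_i] of one variable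
    each.  As [x0_i > 0], each of them is at least [x0_i |y_i|] up to a constant:
    the linear term alone gives this for [y_i <= 0], and the exponential
    dominates [2 x0_i y_i] for [y_i >= 0].  Full row rank makes [l] a linear
    function of [y], so [- G] grows at least linearly in the norm of [l]. *)

Lemma enorm_infty_filter (R : realType) (m : nat) : Filter (enorm_infty R m).
Proof.
apply: filter_from_filter; first by exists 0.
move=> r s _ _; exists (Num.max r s) => // v /=.
by rewrite gt_max => /andP[].
Qed.

(** Each absolute entry is at most the whole sum, so the square of the sum is at least the sum of
    squares. *)
Lemma enorm_le_sum (R : realType) (m : nat) (v : 'cV[R]_m) :
  enorm v <= \sum_(i < m) `|v i 0|.
Proof.
have S0 : 0 <= \sum_(i < m) `|v i 0| by exact: sumr_ge0.
rewrite /enorm -[leRHS](ger0_norm S0) -sqrtr_sqr ler_wsqrtr //.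
rewrite [leRHS]expr2 mulr_suml ler_sum // => i _.
rewrite -real_normK ?num_real // expr2 ler_wpM2l //.
by rewrite (bigD1 i) //= lerDl sumr_ge0.
Qed.

(** The tangent to the exponential term with slope [2 * x] in [y] keeps slope [x] once [x * y] is
    subtracted, which settles [y >= 0]; for [y < 0] positivity of the exponential suffices. *)
Lemma expR_sub_linear_ge (R : realType) (k eps x c : R) :
  0 < k -> 0 < eps -> 0 < x ->
  exists K, forall y, x * `|y| - K <= k * expR ((y - c) / eps) - x * y.
Proof.
move=> k0 e0 x0.
(* [t] is where [k * expR] has slope [2 * x * eps] *)
set t := ln (2 * x * eps / k).
have et : k * expR t = 2 * x * eps.
  rewrite lnK ?posrE ?divr_gt0 ?mulr_gt0 //; field; exact: lt0r_neq0.
(* The absolute value of the tangent's intercept serves both signs of [y]. *)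
exists `|2 * x * (eps * (1 - t) - c)| => y.
have tangent : 2 * x * y + 2 * x * (eps * (1 - t) - c)
               <= k * expR ((y - c) / eps).
  rewrite -[(y - c) / eps](subrKC t) expRD mulrA et.
  have -> : 2 * x * y + 2 * x * (eps * (1 - t) - c)
            = 2 * x * eps * (1 + ((y - c) / eps - t)).
    by field; exact: lt0r_neq0.
  by rewrite ler_wpM2l ?expR_ge1Dx // ltW ?mulr_gt0.
have := ler_norm (- (2 * x * (eps * (1 - t) - c))); rewrite normrN.
have := normr_ge0 (2 * x * (eps * (1 - t) - c)).
have kexp0 : 0 <= k * expR ((y - c) / eps) by rewrite mulr_ge0 ?expR_ge0 ?ltW.
have [y0|y0] := ger0P y; lra.
Qed.

(** Full row rank makes [pinvmx A] a right inverse of [A], so [l] is recovered from [A^T *m l];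
    coordinate [i] enters with coefficients of total size [w i]. *)
Lemma enorm_le_weighted (R : realType) (m d : nat) (A : 'M[R]_(m, d))
    (x : 'I_d -> R) : row_free A -> (forall i, 0 < x i) ->
  exists2 M, 0 < M &
    forall l : 'cV[R]_m, enorm l <= M * \sum_(i < d) x i * `|(A^T *m l) i 0|.
Proof.
move=> hA x0; pose w i := \sum_(j < m) `|pinvmx A i j|.
have w0 i : 0 <= w i by exact: sumr_ge0.
have q0 i : 0 <= w i / x i by rewrite divr_ge0 // ltW.
(* The sum dominates every ratio [w i / x i]; the added 1 keeps the constant positive even when
   [d = 0]. *)
exists (1 + \sum_i w i / x i); first by rewrite ltr_pwDl ?sumr_ge0.
move=> l; apply: (le_trans (enorm_le_sum _ _ _)).
have lE : l = (pinvmx A)^T *m (A^T *m l).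
  by rewrite mulmxA -trmx_mul mulmxVp // trmx1 mul1mx.
have -> : \sum_(j < m) `|l j 0|
  = \sum_(j < m) `|((pinvmx A)^T *m (A^T *m l)) j 0| by rewrite -lE.
set y := A^T *m l.
apply: (@le_trans _ _ (\sum_i w i * `|y i 0|)).
  under [leRHS]eq_bigr => i _ do rewrite mulr_suml.
  rewrite exchange_big /= ler_sum // => j _; rewrite mxE.
  apply: (le_trans (ler_norm_sum _ _ _)); apply: ler_sum => i _.
  by rewrite mxE normrM.
rewrite mulr_sumr ler_sum // => i _; rewrite mulrA ler_wpM2r //.
rewrite -ler_pdivrMr // (bigD1 i) //= addrCA lerDl addr_ge0 ?sumr_ge0 //.
Qed.

Lemma Geps_le_linear (R : realType) (m d : nat) (A : 'M[R]_(m, d))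
    (c : 'cV[R]_d) (eps : R) (x0 : 'cV[R]_d) :
  row_free A -> 0 < eps -> (forall i, 0 < x0 i 0) ->
  exists2 M, 0 < M & exists K, forall l : 'cV[R]_m,
    enorm l / M - K <= - Geps A (A *m x0) c eps l.
Proof.
move=> hA e0 x0_gt0.
have [M M0 lM] := @enorm_le_weighted _ _ _ _ (fun i => x0 i 0) hA x0_gt0.
have k0 : 0 < eps / expR 1 by rewrite divr_gt0 ?expR_gt0.
have /choice[K KP] : forall i, exists K, forall y, x0 i 0 * `|y| - K
    <= eps / expR 1 * expR ((y - c i 0) / eps) - x0 i 0 * y.
  by move=> i; exact: expR_sub_linear_ge.
exists M => //; exists (\sum_i K i) => l.
have GE : - Geps A (A *m x0) c eps l = \sum_i
    (eps / expR 1 * expR (((A^T *m l) i 0 - c i 0) / eps)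
     - x0 i 0 * (A^T *m l) i 0).
  rewrite /Geps opprB trmx_mul -mulmxA sumrB -mulr_sumr [(x0^T *m _) 0 0]mxE.
  by congr (_ * _ - _); apply: eq_bigr => i _; rewrite !mxE.
rewrite GE; apply: (@le_trans _ _
    (\sum_i (x0 i 0 * `|(A^T *m l) i 0| - K i))); last exact: ler_sum.
by rewrite sumrB lerB // ler_pdivrMr // mulrC.
Qed.

Theorem lemma2p2 (R : realType) (m d : nat) (A : 'M[R]_(m, d))
    (b : 'cV[R]_m) (c : 'cV[R]_d) (eps : R)
    (hA : row_free A) (heps : 0 < eps)
    (hx0 : exists x0 : 'cV[R]_d, A *m x0 = b /\ forall i : 'I_d, 0 < x0 i 0) :
  coercive (fun l : 'cV[R]_m => - Geps A b c eps l) /\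
  Geps A b c eps l @[l --> enorm_infty R m] --> -oo.
Proof.
have FF := enorm_infty_filter R m.
have cvg_oppG : coercive (fun l : 'cV[R]_m => - Geps A b c eps l).
  case: hx0 => x0 [<- x0_gt0].
  have [M M0 [K GK]] := @Geps_le_linear _ _ _ A c _ _ hA heps x0_gt0.
  (* Once [enorm l] exceeds [M * (T + K)], the linear lower bound exceeds [T]. *)
  apply/cvgryPge => T; exists (M * (T + K)) => // l /= lT.
  apply: le_trans (GK l).
  by rewrite lerBrDr ler_pdivlMr // mulrC ltW.
by split=> //; apply/cvgNry.
Qed.
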